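(* For every positive integer $k$ more than $2$, there exists a finite simplicial graph $\Gamma$ such that $A(\Gamma)$ contains an element whose asymptotic translation length on the extension graph $\Gamma^e$ is $3+(1/k)$.
   Context: All defining graphs are assumed connected. For a finite connected simplicial graph $\Gamma$, $A(\Gamma)=\langle v\in V(\Gamma)\mid [u,v]=1 \text{ for all } \{u,v\}\in E(\Gamma)\rangle$ is its right-angled Artin group. For $x,h\in A(\Gamma)$ write $x^h=h^{-1}xh$. The extension graph $\Gamma^e$ is the simplicial graph with vertex set $\{v^g\mid v\in V(\Gamma), g\in A(\Gamma)\}\subset A(\Gamma)$, where two distinct vertices are joined by an edge exactly when they commute in $A(\Gamma)$. It carries the edge metric $d_{\Gamma^e}$. $A(\Gamma)$ acts on $\Gamma^e$ on the right by conjugation, $x\mapsto x^g$. The asymptotic translation length of $g$ is $\tau(g)=\lim_{n\to\infty} d_{\Gamma^e}(x,x^{g^n})/n$ (independent of the vertex $x$). *)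

(* Defs.v *)
From HB Require Import structures.
From mathcomp Require Import all_boot all_order all_algebra.
From mathcomp Require Import all_classical all_reals all_analysis.
Import Order.TTheory GRing.Theory Num.Theory numFieldNormedType.Exports.

Set Implicit Arguments.
Unset Strict Implicit.
Unset Printing Implicit Defensive.

Local Open Scope group_scope.
Local Open Scope quotient_scope.
Local Open Scope classical_set_scope.

(* The empty graph is excluded: a connected graph is nonempty by convention. *)
Record connected_graph := ConnectedGraph {
  vertex :> finType;
  adj : rel vertex;
  adj_sym : symmetric adj;
  adj_irr : irreflexive adj;
  vertex_inhabited : (0 < #|vertex|)%N;
  adj_connected : forall u v, connect adj u v }.

Section RightAngledArtinGroup.
Variable G : connected_graph.

(* The letter (v, false) stands for v and (v, true) for v^-1. *)
Definition word : Type := seq (G * bool).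

HB.instance Definition _ := Choice.on word.

Inductive word_equiv : word -> word -> Prop :=
| word_equiv_refl w : word_equiv w w
| word_equiv_sym w1 w2 : word_equiv w1 w2 -> word_equiv w2 w1
| word_equiv_trans w1 w2 w3 :
    word_equiv w1 w2 -> word_equiv w2 w3 -> word_equiv w1 w3
| word_equiv_cancel (s t : word) v b :
    word_equiv (s ++ [:: (v, b), (v, ~~ b) & t]) (s ++ t)
| word_equiv_comm (s t : word) u v : adj u v ->
    word_equiv (s ++ [:: (u, false), (v, false) & t])
               (s ++ [:: (v, false), (u, false) & t]).

Definition word_eqb : rel word := fun w1 w2 => `[< word_equiv w1 w2 >].

Lemma word_eqb_refl : reflexive word_eqb.
Proof. by move=> w; apply/asboolP; exact: word_equiv_refl. Qed.

Lemma word_eqb_sym : symmetric word_eqb.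
Proof.
by move=> w1 w2; apply/asboolP/asboolP; exact: word_equiv_sym.
Qed.

Lemma word_eqb_trans : transitive word_eqb.
Proof.
move=> w2 w1 w3 /asboolP h12 /asboolP h23; apply/asboolP.
exact: word_equiv_trans h12 h23.
Qed.

Canonical word_equiv_rel :=
  EquivRel word_eqb word_eqb_refl word_eqb_sym word_eqb_trans.

Definition raag : Type := {eq_quot word_equiv_rel}.

HB.instance Definition _ := Choice.on raag.
HB.instance Definition _ := EqQuotient.on raag.

Lemma raag_eqP (w1 w2 : word) :
  \pi_raag w1 = \pi_raag w2 <-> word_equiv w1 w2.
Proof.
split=> [/eqmodP/asboolP //|h].
by apply/eqmodP/asboolP.
Qed.

Lemma word_equiv_cat (s1 s2 t1 t2 : word) :
  word_equiv s1 s2 -> word_equiv t1 t2 -> word_equiv (s1 ++ t1) (s2 ++ t2).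
Proof.
move=> hs ht; apply: (@word_equiv_trans _ (s2 ++ t1)).
- elim: hs t1 {ht} => {s1 s2}.
  + by move=> w t; exact: word_equiv_refl.
  + by move=> w1 w2 _ ih t; apply: word_equiv_sym.
  + by move=> w1 w2 w3 _ ih1 _ ih2 t; exact: word_equiv_trans (ih1 t) (ih2 t).
  + by move=> s t v b t1; rewrite -!catA /=; exact: word_equiv_cancel.
  + by move=> s t u v huv t1; rewrite -!catA /=; exact: word_equiv_comm.
- elim: ht s2 {hs} => {t1 t2}.
  + by move=> w s; exact: word_equiv_refl.
  + by move=> w1 w2 _ ih s; apply: word_equiv_sym.
  + by move=> w1 w2 w3 _ ih1 _ ih2 s; exact: word_equiv_trans (ih1 s) (ih2 s).
  + by move=> s t v b s2; rewrite !catA; exact: word_equiv_cancel.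
  + by move=> s t u v huv s2; rewrite !catA; exact: word_equiv_comm.
Qed.

Definition word_inv (w : word) : word := rev [seq (x.1, ~~ x.2) | x <- w].

Lemma word_inv_cat (s t : word) : word_inv (s ++ t) = word_inv t ++ word_inv s.
Proof. by rewrite /word_inv map_cat rev_cat. Qed.

Lemma word_invK (w : word) : word_inv (word_inv w) = w.
Proof.
rewrite /word_inv map_rev revK -map_comp -[RHS]map_id.
by apply: eq_map => -[v b] /=; rewrite negbK.
Qed.

Lemma word_mulV (w : word) : word_equiv (w ++ word_inv w) [::].
Proof.
elim/last_ind: w => [|w [v b] ih]; first exact: word_equiv_refl.
rewrite -cats1 word_inv_cat -catA /=.
exact: word_equiv_trans (word_equiv_cancel _ _ _ _) ih.
Qed.

Lemma word_Vmul (w : word) : word_equiv (word_inv w ++ w) [::].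
Proof. by rewrite -{2}(word_invK w); exact: word_mulV. Qed.

Lemma word_equiv_inv (s t : word) :
  word_equiv s t -> word_equiv (word_inv s) (word_inv t).
Proof.
move=> h; have e := word_equiv_cat (word_equiv_refl (word_inv s))
  (word_equiv_cat h (word_equiv_refl (word_inv t))).
have e1 := word_equiv_cat (word_Vmul s) (word_equiv_refl (word_inv t)).
have e2 := word_equiv_cat (word_equiv_refl (word_inv s)) (word_mulV t).
rewrite -catA /= in e1; rewrite cats0 in e2.
exact: word_equiv_trans (word_equiv_sym (word_equiv_trans e e2)) e1.
Qed.

Definition raag_one : raag := \pi_raag [::].
Definition raag_mul (x y : raag) : raag := \pi_raag (repr x ++ repr y).
Definition raag_inv (x : raag) : raag := \pi_raag (word_inv (repr x)).

Lemma repr_pi (w : word) : word_equiv (repr (\pi_raag w)) w.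
Proof. by apply/raag_eqP; rewrite reprK. Qed.

Lemma raag_mul_pi (s t : word) :
  raag_mul (\pi_raag s) (\pi_raag t) = \pi_raag (s ++ t).
Proof. by apply/raag_eqP; apply: word_equiv_cat; exact: repr_pi. Qed.

Lemma raag_inv_pi (s : word) : raag_inv (\pi_raag s) = \pi_raag (word_inv s).
Proof. by apply/raag_eqP; apply: word_equiv_inv; exact: repr_pi. Qed.

Lemma raag_wordP (x : raag) : exists w : word, x = \pi_raag w.
Proof. by exists (repr x); rewrite reprK. Qed.

Lemma raag_mulA : associative raag_mul.
Proof.
move=> x y z; have [s ->] := raag_wordP x; have [t ->] := raag_wordP y.
have [u ->] := raag_wordP z.
by rewrite (raag_mul_pi t u) (raag_mul_pi s t) !raag_mul_pi catA.
Qed.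

Lemma raag_mul1 : left_id raag_one raag_mul.
Proof. by move=> x; have [s ->] := raag_wordP x; rewrite raag_mul_pi. Qed.

Lemma raag_mulr1 : right_id raag_one raag_mul.
Proof.
by move=> x; have [s ->] := raag_wordP x; rewrite raag_mul_pi cats0.
Qed.

Lemma raag_mulV : left_inverse raag_one raag_inv raag_mul.
Proof.
move=> x; have [s ->] := raag_wordP x.
by rewrite raag_inv_pi raag_mul_pi; apply/raag_eqP; exact: word_Vmul.
Qed.

Lemma raag_mulrV : right_inverse raag_one raag_inv raag_mul.
Proof.
move=> x; have [s ->] := raag_wordP x.
by rewrite raag_inv_pi raag_mul_pi; apply/raag_eqP; exact: word_mulV.
Qed.

HB.instance Definition _ := isGroup.Build raag
  raag_mulA raag_mul1 raag_mulr1 raag_mulV raag_mulrV.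

Definition raag_gen (v : G) : raag := \pi_raag [:: (v, false)].

Definition ext_vertex : set raag :=
  [set x | exists (v : G) (g : raag), x = raag_gen v ^ g].

Definition ext_adj : rel raag := fun x y =>
  `[< [/\ ext_vertex x, ext_vertex y, x <> y & commute x y] >].

Definition ext_walk (x y : raag) (n : nat) : Prop :=
  exists p : seq raag, [/\ path ext_adj x p, last x p = y & size p = n].

(* The default value 0 is never used on vertices, see [ext_connected]. *)
Definition ext_dist (x y : raag) : nat :=
  if pselect (exists n, `[< ext_walk x y n >]) is left h then ex_minn h else 0.

Lemma ext_walk_cat x y z m n :
  ext_walk x y m -> ext_walk y z n -> ext_walk x z (m + n).
Proof.
move=> [p [hp <- <-]] [q [hq <- <-]]; exists (p ++ q).
by rewrite cat_path hp hq last_cat size_cat.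
Qed.

Lemma ext_vertexJ x g : ext_vertex x -> ext_vertex (x ^ g).
Proof. by move=> [v [h ->]]; exists v, (h * g); rewrite conjgM. Qed.

Lemma ext_adjJ x y g : ext_adj x y -> ext_adj (x ^ g) (y ^ g).
Proof.
move=> /asboolP[hx hy nxy cxy]; apply/asboolP; split; try exact: ext_vertexJ.
- by move=> /conjg_inj.
- by rewrite /commute -!conjMg cxy.
Qed.

Lemma ext_walkJ x y n g : ext_walk x y n -> ext_walk (x ^ g) (y ^ g) n.
Proof.
move=> [p [hp <- <-]]; exists [seq z ^ g | z <- p].
rewrite size_map (last_map (fun z => z ^ g)); split=> //.
elim: p x hp => //= z p ih x /andP[hxz hp].
by rewrite ext_adjJ //= ih.
Qed.

Lemma ext_walk_sym x y n : ext_walk x y n -> ext_walk y x n.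
Proof.
move=> [p [hp <- <-]]; exists (rev (belast x p)); split.
- rewrite rev_path; apply: (sub_path _ hp) => a b /asboolP[ha hb nab cab].
  by apply/asboolP; split=> //; apply/nesym.
- by case: p {hp} => //= a p; rewrite rev_cons last_rcons.
- by rewrite size_rev size_belast.
Qed.

Lemma raag_gen_connected u v : exists n, ext_walk (raag_gen u) (raag_gen v) n.
Proof.
have hg w : ext_vertex (raag_gen w) by exists w, 1; rewrite conjg1.
have /connectP[p hp ->] := adj_connected u v.
elim: p u hp => [|w p ih] u /=; first by exists 0, [::].
move=> /andP[huw /ih[n hn]].
have cuw : commute (raag_gen u) (raag_gen w).
  rewrite /commute -[LHS]/(raag_mul _ _) -[RHS]/(raag_mul _ _) !raag_mul_pi.
  by apply/raag_eqP; exact: (word_equiv_comm [::] [::]).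
have [e|ne] := pselect (raag_gen u = raag_gen w); first by exists n; rewrite e.
exists (1 + n); apply: (ext_walk_cat _ hn); exists [:: raag_gen w]; split=> //=.
by rewrite andbT; apply/asboolP.
Qed.

Lemma ext_connected x y :
  ext_vertex x -> ext_vertex y -> exists n, ext_walk x y n.
Proof.
have key u v g : exists n, ext_walk (raag_gen u) (raag_gen v ^ g) n.
  have stepV w : \pi_raag [:: (w, true)] = (raag_gen w)^-1.
    by rewrite -[RHS]/(raag_inv _) raag_inv_pi.
  have [s ->] := raag_wordP g; elim/last_ind: s => [|s [w b] [n hn]].
    by rewrite -[\pi_raag [::]]/(1 : raag) conjg1; exact: raag_gen_connected.
  have -> : \pi_raag (rcons s (w, b)) =
      \pi_raag s * \pi_raag [:: (w, b)] :> raag.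
    by rewrite -cats1 -[RHS]/(raag_mul _ _) raag_mul_pi.
  set h := \pi_raag [:: (w, b)].
  have fixw : raag_gen w ^ h = raag_gen w.
    apply/conjg_fixP/commgP; rewrite /h; case: (b); rewrite ?stepV //.
    exact/commuteV.
  have [m hm] := raag_gen_connected u w; rewrite conjgM.
  exists ((m + m) + n); apply: (ext_walk_cat _ (ext_walkJ h hn)).
  apply: (ext_walk_cat hm); rewrite -{1}fixw; apply: ext_walkJ.
  exact: ext_walk_sym hm.
move=> [u [g ->]] [v [h ->]].
have [n hn] := key u v (h * g^-1).
exists n; have := ext_walkJ g hn.
by rewrite -conjgM -mulgA mulVg mulg1.
Qed.

End RightAngledArtinGroup.

(* The limit does not depend on x; quantifying over every vertex x is how the
   definition avoids choosing one. *)
Definition asymptotic_translation_length (R : realType) (G : connected_graph)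
    (g : raag G) (l : R) : Prop :=
  forall x : raag G, ext_vertex x ->
    ((ext_dist x (x ^ (g ^+ n))%g)%:R / n%:R : R)%R @[n --> \oo] --> l.

(* Main.v *)
(* The graph is a cycle p_0, ..., p_{3k} with three pairwise non-adjacent cone
   vertices c_0, c_1, c_2, where c_j is joined to the p_i with i < 3k and
   i = j mod 3; the element is g = c_2 c_1 c_0. Turning once around the cycle
   and conjugating by the cone vertex of p_i on the way joins p_0 to
   p_0^(g^k) by a path of length 3k + 1.
   Conversely, send the p_i to 1 and each c_j to the j-th generator of the
   free product W of three copies of Z/2. A vertex v^h determines a coset in W,
   namely the image of the centralizer of v times h, and commuting vertices
   determine cosets that meet. So a path from p_0 to p_0^(g^n) follows a walk
   in the graph along which the reduced word (c_2 c_1 c_0)^n is spelled with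
   one letter at most per vertex. Consecutive letters can be spelled without
   an intermediate step only while moving forward along p_0, ..., p_{3k-1};
   so every run of 3k letters costs at least one extra step. *)
Require Import Defs.
From mathcomp Require Import all_boot all_order all_algebra.
From mathcomp Require Import all_classical all_reals all_analysis.
From mathcomp Require Import zify ring lra.
Import Order.TTheory GRing.Theory Num.Theory numFieldNormedType.Exports.

Set Implicit Arguments.
Unset Strict Implicit.
Unset Printing Implicit Defensive.

Local Open Scope group_scope.
Local Open Scope quotient_scope.

(** * Actions of the group in which every generator acts as an involution *)

Section InvolutiveActions.
Variable G : connected_graph.

Definition involutive_action (X : Type) (act : G -> X -> X) : Prop :=
  (forall v, involutive (act v)) /\
  (forall u v x, adj u v -> act u (act v x) = act v (act u x)).

(** The exponent of a letter is dropped because an involution is its own inverse; [foldl] makes this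
    a right action. *)
Definition word_act X (act : G -> X -> X) (w : word G) (x : X) : X :=
  foldl (fun y l => act l.1 y) x w.

Definition raag_act X (act : G -> X -> X) (g : raag G) : X -> X :=
  word_act act (repr g).

Section Theory.
Variables (X : Type) (act : G -> X -> X).
Hypothesis act_inv : involutive_action act.

Lemma word_act_equiv (w1 w2 : word G) x :
  word_equiv w1 w2 -> word_act act w1 x = word_act act w2 x.
Proof.
case: act_inv => inv com; rewrite /word_act.
elim=> // [w s t _ -> _ ->|s t v b|s t u v uv] //; rewrite !foldl_cat /=.
- by rewrite inv.
- by rewrite (com _ _ _ uv).
Qed.

Lemma raag_act_pi w x : raag_act act (\pi_(raag G) w) x = word_act act w x.
Proof. by apply: word_act_equiv; exact: repr_pi. Qed.

Lemma raag_actM g h x : raag_act act (g * h) x = raag_act act h (raag_act act g x).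
Proof. by rewrite -[g * h]/(raag_mul g h) raag_act_pi /word_act foldl_cat. Qed.

Lemma raag_act1 x : raag_act act 1 x = x.
Proof. by rewrite -[1]/(\pi_(raag G) [::]) raag_act_pi. Qed.

Lemma raag_act_gen v x : raag_act act (raag_gen v) x = act v x.
Proof. by rewrite raag_act_pi. Qed.

Lemma raag_actK g : cancel (raag_act act g) (raag_act act g^-1).
Proof. by move=> x; rewrite -raag_actM mulgV raag_act1. Qed.

Lemma raag_actKV g : cancel (raag_act act g^-1) (raag_act act g).
Proof. by move=> x; rewrite -raag_actM mulVg raag_act1. Qed.

Lemma raag_act_genV v x : raag_act act (raag_gen v)^-1 x = act v x.
Proof.
apply: (can_inj (raag_actK (raag_gen v))).
by rewrite raag_actKV raag_act_gen act_inv.1.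
Qed.

Lemma raag_act_commute g h x :
  commute g h -> raag_act act g (raag_act act h x) = raag_act act h (raag_act act g x).
Proof. by move=> gh; rewrite -!raag_actM gh. Qed.

Lemma raag_act_conj v h x :
  raag_act act (raag_gen v ^ h) x =
  raag_act act h (act v (raag_act act h^-1 x)).
Proof. by rewrite conjgE !raag_actM raag_act_gen. Qed.

End Theory.

(** * Dihedral extensions of an action, which detect non-commuting conjugates *)

Section DihedralExtension.
Variables (X : Type) (act : G -> X -> X) (v w : G) (S T : X -> bool).
Hypothesis act_inv : involutive_action act.
Hypothesis Sstable : forall u x, (u == v) || adj u v -> S (act u x) = S x.
Hypothesis Tstable : forall u x, (u == w) || adj u w -> T (act u x) = T x.
Hypothesis ST : (v == w) || adj v w -> forall x, ~~ (S x && T x).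

(* Over S the vertex v acts by (i, j) |-> (~ i, j), and over T the vertex w
   acts by (i, j) |-> (i, i + j); these two involutions generate a dihedral
   group of order 8, whose commutators are central. *)
Definition dihedral_ext (u : G) (x : X * (bool * bool)) : X * (bool * bool) :=
  let: (y, (i, j)) := x in
  (act u y, (i (+) ((u == v) && S y), j (+) ((u == w) && T y && i))).

(** The flip of [v] and the shear of [w] conflict only at points of both [S] and [T], which [ST]
    excludes when [v] and [w] are equal or adjacent. *)
Lemma dihedral_ext_inv : involutive_action dihedral_ext.
Proof.
case: act_inv => inv com; split.
- move=> u [x [i j]] /=; rewrite inv; congr (_, (_, _)).
  + case: eqP => [->|] /=; last by rewrite !addbF.
    by rewrite Sstable ?eqxx // -addbA addbb addbF.
  + case: eqP => [uw|] /=; last by rewrite !addbF.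
    rewrite uw Tstable ?eqxx //; case: (eqVneq w v) => [wv|_] /=; last first.
      by rewrite addbF -addbA addbb addbF.
    have := ST _ x; rewrite wv eqxx => /(_ isT).
    by case: (S x) => //=; case: (T x) => //=; rewrite ?addbF -?addbA ?addbb ?addbF.
- move=> a b x0 ab; have ba : adj b a by rewrite adj_sym.
  case: x0 => [x [i j]] /=; rewrite com //; congr (_, (_, _)).
  + rewrite -!addbA; congr (_ (+) _); rewrite addbC.
    case: (eqVneq a v) => [av|_] /=; case: (eqVneq b v) => [bv|_] //=;
      rewrite ?addbF //=.
    * by move: ab; rewrite av bv adj_irr.
    * by rewrite Sstable // -av ba orbT.
    * by rewrite Sstable // -bv ab orbT.
  + rewrite -!addbA; congr (_ (+) _).
    case: (eqVneq a w) => [aw|_] /=; case: (eqVneq b w) => [bw|_] //=;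
      rewrite ?addbF //=.
    * by move: ab; rewrite aw bw adj_irr.
    * rewrite Tstable -?aw ?ba ?orbT //.
      case: eqVneq => [bv|_] /=; last by rewrite addbF.
      have := ST _ x; rewrite -aw -bv ba orbT => /(_ isT).
      by case: (S x) (T x) => [] [] //=; rewrite ?addbF.
    * rewrite Tstable -?bw ?ab ?orbT //.
      case: eqVneq => [av|_] /=; last by rewrite addbF.
      have := ST _ x; rewrite -av -bw ab orbT => /(_ isT).
      by case: (S x) (T x) => [] [] //=; rewrite ?addbF.
Qed.

(** Flip and shear are unitriangular affine maps over the field with two elements, and these are
    closed under composition. *)
Lemma dihedral_ext_affine g x : exists a b c, forall i j,
  raag_act dihedral_ext g (x, (i, j)) =
  (raag_act act g x, (i (+) a, j (+) (b && i) (+) c)).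
Proof.
rewrite /raag_act; elim/last_ind: (repr g) => [|s l [a [b [c IH]]]].
  by exists false, false, false => i j; rewrite /= !addbF.
set y := word_act act s x in IH *.
exists (a (+) ((l.1 == v) && S y)), (b (+) ((l.1 == w) && T y)),
  (c (+) ((l.1 == w) && T y && a)) => i j.
rewrite /word_act -cats1 !foldl_cat /= -/(word_act _ _ _) -/(word_act act s x).
rewrite IH /= -/y; congr (_, (_, _)); first by rewrite addbA.
by case: ((l.1 == w) && T y); case: i j a b c {IH} => [] [] [] [] [].
Qed.

Lemma dihedral_ext_conj h x : let y := raag_act act h^-1 x in
  T y -> act w y = y ->
  exists a, forall i j,
  raag_act dihedral_ext (raag_gen w ^ h) (x, (i, j)) =
  (x, (i, j (+) i (+) a)).
Proof.
move=> y Ty wy; have [a [b [c E]]] := dihedral_ext_affine h^-1 x.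
exists a => i j; rewrite (raag_act_conj dihedral_ext_inv) E -/y /= wy.
have -> : (w == v) && S y = false.
  case: (eqVneq w v) => // wv.
  by have := ST _ y; rewrite wv eqxx Ty andbT => /(_ isT)/negbTE.
rewrite Ty eqxx addbF /=.
apply: (can_inj (raag_actKV dihedral_ext_inv h)).
rewrite (raag_actK dihedral_ext_inv) E.
by congr (_, (_, _)); case: i j a b c {E} => [] [] [] [] [].
Qed.

(** Over [x] the flip of [v] changes [i], hence changes whether the conjugated shear moves [j]: the
    two orders disagree in [j]. *)
Lemma dihedral_ext_noncommute h x : let y := raag_act act h^-1 x in
  S x -> T y -> act v x = x -> act w y = y ->
  ~ commute (raag_gen v) (raag_gen w ^ h).
Proof.
move=> y Sx Ty vx wy cvw.
have [a E] := dihedral_ext_conj Ty wy.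
have := raag_act_commute dihedral_ext_inv (x, (false, false)) cvw.
rewrite E !(raag_act_gen dihedral_ext_inv) /= vx Sx eqxx E /= andbF addbF.
by case: a {E}.
Qed.

(** The shifts of [i] along [h^-1] and [h] cancel, so the first bit tests membership in [S] of the
    translated point. *)
Lemma dihedral_ext_flip h x i j : (forall y, act v y = y) ->
  (raag_act dihedral_ext (raag_gen v ^ h) (x, (i, j))).2.1 =
  i (+) S (raag_act act h^-1 x).
Proof.
move=> vid; have [a [b [c E]]] := dihedral_ext_affine h^-1 x.
rewrite (raag_act_conj dihedral_ext_inv) E /= vid eqxx.
have [a' [b' [c' E']]] := dihedral_ext_affine h (raag_act act h^-1 x).
have := raag_actKV dihedral_ext_inv h (x, (i, j)).
rewrite E E' /= => -[_ + _].
rewrite E' /=; by case: i a a' (S _) {E E'} => [] [] [] [].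
Qed.

End DihedralExtension.
End InvolutiveActions.

(** * Free products of copies of Z/2 through reduced words *)

Section ReducedWords.
Variable C : eqType.

Definition no_repeat (s : seq C) : bool := sorted (fun a b => a != b) s.

(* The free product of copies of Z/2 indexed by C. The head of the list is the
   last letter of the word, so [toggle] is right multiplication. *)
Definition coxeter : Type := {s : seq C | no_repeat s}.

Definition toggle_seq (c : C) (s : seq C) : seq C :=
  if s is d :: s' then if d == c then s' else c :: s else [:: c].

Lemma no_repeat_toggle c s : no_repeat s -> no_repeat (toggle_seq c s).
Proof.
case: s => [|d s] //= ds; case: eqVneq => [_|dc]; last by rewrite /= eq_sym dc.
by case: s ds => //= e s /andP[].
Qed.

Definition toggle (c : C) (x : coxeter) : coxeter :=
  exist _ (toggle_seq c (val x)) (no_repeat_toggle c (valP x)).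

Definition coxeter1 : coxeter := exist _ [::] isT.

Lemma toggleK c : involutive (toggle c).
Proof.
case=> s hs; apply: val_inj => /=; case: s hs => [|d s] /=; first by rewrite eqxx.
case: eqVneq => [<-|dc] /=; last by rewrite eqxx.
by case: s => //= e s /andP[de _]; rewrite eq_sym (negbTE de).
Qed.

Lemma toggle_neq c x : toggle c x <> x.
Proof.
case: x => -[|d s] hs /(congr1 val) //=; case: eqP => _ /(congr1 size) /=; lia.
Qed.

Lemma toggle_subseq c x s :
  subseq (val x) s -> subseq (val (toggle c x)) (c :: s).
Proof.
case: x => -[|d t] ht /= h; first by rewrite eqxx sub0seq.
case: (eqVneq d c) => [_|dc] /=; last by rewrite eqxx.
by apply: subseq_trans (subseq_cons _ _); apply: subseq_trans h; exact: subseq_cons.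
Qed.

Lemma foldr_toggle_cat s (x : coxeter) : no_repeat (s ++ val x) ->
  val (foldr toggle x s) = s ++ val x.
Proof.
elim: s => //= d s IH hs; rewrite IH; last by exact: path_sorted hs.
by case: (s ++ val x) hs => //= e t /andP[de _]; rewrite eq_sym (negbTE de).
Qed.

(** The hypothesis compares the reduced forms of c x and x c, so the centralizer of [c] is {1, c}.
    The proof splits on whether the first letter of the word, the last entry of the list, is [c]. *)
Lemma toggle_centralizer c (x : coxeter) :
  foldr toggle (toggle c coxeter1) (val x) = toggle c x ->
  x = coxeter1 \/ x = toggle c coxeter1.
Proof.
case: x => s hs /= /(congr1 val) /= E.
suff: s = [::] \/ s = [:: c] by case=> Es; [left|right]; exact: val_inj.
move: hs E; case/lastP: s => [|s d]; first by left.
case: (eqVneq d c) => [->|dc] hs.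
  rewrite foldr_rcons toggleK foldr_toggle_cat cats0; last first.
    by move: hs; rewrite -cats1 => /cat_sorted2[].
  case: s hs => [|e s] hs /=; first by right.
  case: eqP => [ec|_]; last by move/(congr1 size); rewrite /= size_rcons; lia.
  case: s hs => [|e' s] /=; rewrite ec ?eqxx // => /andP[+ _] [e'c].
  by rewrite e'c eqxx.
have hsc : no_repeat (rcons s d ++ [:: c]).
  move: hs; rewrite /no_repeat; case: s => [|e s] /=; first by rewrite dc.
  by rewrite cats1 !rcons_path last_rcons => ->.
rewrite foldr_toggle_cat //.
case: s hs hsc => [|e s] hs hsc /=.
  by rewrite (negbTE dc) => -[dc']; rewrite dc' eqxx in dc.
case: eqP => [_|ec]; last by case=> ec'; case: ec.
by move/(congr1 size) => /=; rewrite size_cat /=; lia.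
Qed.

Section CoxeterAction.
Variables (G : connected_graph) (letter : G -> option C).

Definition coxeter_act (v : G) (x : coxeter) : coxeter :=
  oapp (fun c => toggle c x) x (letter v).

Hypothesis letter_indep :
  forall u v c d, letter u = Some c -> letter v = Some d -> ~~ adj u v.

Lemma coxeter_act_inv : involutive_action coxeter_act.
Proof.
rewrite /coxeter_act; split=> [v x|u v x uv].
  by case: (letter v) => //= c; rewrite toggleK.
case Eu: (letter u) => [c|] //=; case Ev: (letter v) => [d|] //=.
by have := letter_indep Eu Ev; rewrite uv.
Qed.

(** The action is right multiplication through a homomorphism to the free product, so the image of
    the identity determines it. *)
Lemma coxeter_act_free g x :
  raag_act coxeter_act g x =
  foldr toggle x (val (raag_act coxeter_act g coxeter1)).
Proof.
rewrite /raag_act; elim/last_ind: (repr g) => //= s l IH.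
rewrite /word_act -cats1 !foldl_cat /= -!/(word_act _ _ _) IH.
rewrite /coxeter_act; case: (letter l.1) => //= c.
case: (word_act _ s _) => -[|d t] ht //=.
by case: eqP => [->|//]; rewrite toggleK.
Qed.

Lemma coxeter_act_centralizer g c :
  raag_act coxeter_act g (toggle c coxeter1) =
    toggle c (raag_act coxeter_act g coxeter1) ->
  (forall x, raag_act coxeter_act g x = x) \/
  (forall x, raag_act coxeter_act g x = toggle c x).
Proof.
rewrite coxeter_act_free => /toggle_centralizer[] E; [left|right] => x;
  by rewrite coxeter_act_free E.
Qed.

End CoxeterAction.
End ReducedWords.

(** * Cosets attached to the vertices of the extension graph *)

Definition star (G : connected_graph) : rel G := fun u v => (u == v) || adj u v.

Lemma star_sym (G : connected_graph) : symmetric (@star G).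
Proof. by move=> u v; rewrite /star eq_sym adj_sym. Qed.

Section ExtensionGraphCosets.
Variables (C : eqType) (G : connected_graph) (letter star_letter : G -> option C).

(* [letter v] gives the image of v in the free product of copies of Z/2, and
   [star_letter v] the generator of the image of the centralizer of v. *)
Hypothesis letter_indep :
  forall u v c d, letter u = Some c -> letter v = Some d -> ~~ adj u v.
Hypothesis letter_star :
  forall u v c, star u v -> letter u = Some c -> star_letter v = Some c.

Local Notation base_act := (coxeter_act letter).
Local Notation e1 := (coxeter1 C).
Let base_inv : involutive_action base_act := coxeter_act_inv letter_indep.

(** Since [toggle] multiplies on the right, these are left cosets: the vertex [v ^ h] is given the
    coset of [h^-1], the inverse of the one containing [h]. *)
Definition in_coset (v : G) (x y : coxeter C) : bool :=
  (y == x) || (if star_letter v is Some c then y == toggle c x else false).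

Lemma in_coset_refl v x : in_coset v x x.
Proof. by rewrite /in_coset eqxx. Qed.

Lemma in_coset_sym v x y : in_coset v x y -> in_coset v y x.
Proof.
rewrite /in_coset => /orP[/eqP->|]; first by rewrite eqxx.
by case: (star_letter v) => // c /eqP->; rewrite toggleK eqxx orbT.
Qed.

Lemma in_coset_trans v x y z : in_coset v x y -> in_coset v y z -> in_coset v x z.
Proof.
rewrite /in_coset => /orP[/eqP-> //|]; case: (star_letter v) => // c /eqP->.
by rewrite toggleK orbC.
Qed.

Lemma in_coset_act u v x y : star u v -> in_coset v x (base_act u y) = in_coset v x y.
Proof.
move=> uv; rewrite /coxeter_act; case E: (letter u) => [c|] //=.
rewrite /in_coset (letter_star uv E) (inj_eq (can_inj (toggleK c))).
by rewrite (can2_eq (toggleK c) (toggleK c)) orbC.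
Qed.

Lemma in_coset_subseq v x y t : in_coset v x y ->
  subseq (val x) (pmap star_letter t) -> subseq (val y) (pmap star_letter (v :: t)).
Proof.
rewrite /in_coset /= => /orP[/eqP->|].
  by case: (star_letter v) => //= c h; apply: subseq_trans h (subseq_cons _ _).
by case: (star_letter v) => //= c /eqP->; exact: toggle_subseq.
Qed.

(** Over a one-point action [S] and [T] can be everything: for [v] and [w] distinct and
    non-adjacent, [ST] is vacuous. *)
Lemma commute_star (v w : G) h : commute (raag_gen v) (raag_gen w ^ h) -> star v w.
Proof.
move=> cvw; apply: contraT => nvw.
pose act (_ : G) (x : unit) := x.
have act_inv : involutive_action act by [].
have ST : star v w -> forall x : unit, ~~ (xpredT x && xpredT x).
  by rewrite (negbTE nvw).
by have := @dihedral_ext_noncommute G unit act v w xpredT xpredT act_inv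
  (fun _ _ _ => erefl) (fun _ _ _ => erefl) ST h tt isT isT erefl erefl cvw.
Qed.

(** Let [w] flip over its coset at the image of [e1] under [h^-1]. Since [v] commutes with [w ^ h],
    the flip must agree at [e1] and at [toggle c e1], so [h^-1] maps both into one coset and
    therefore commutes with [c]. *)
Lemma commute_cone (v w : G) h c :
  letter v = Some c -> letter w = None -> commute (raag_gen v) (raag_gen w ^ h) ->
  (forall x, raag_act base_act h^-1 x = x) \/
  (forall x, raag_act base_act h^-1 x = toggle c x).
Proof.
move=> vc w0 cvw; apply: coxeter_act_centralizer.
have wc := letter_star (commute_star cvw) vc.
set x' := raag_act base_act h^-1 e1.
have Sst u x : star u w -> in_coset w x' (base_act u x) = in_coset w x' x.
  exact: in_coset_act.
have wid y : base_act w y = y by rewrite /coxeter_act w0.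
have disj : star w v -> forall x : coxeter C, ~~ (in_coset w x' x && xpred0 x).
  by move=> _ x; rewrite andbF.
have ext_inv := @dihedral_ext_inv G _ _ w v _ xpred0 base_inv Sst
  (fun _ _ _ => erefl) disj.
have flip := @dihedral_ext_flip G _ _ w v _ xpred0 base_inv Sst
  (fun _ _ _ => erefl) disj h _ _ _ wid.
have wv : (v == w) = false by apply/eqP => wv; rewrite wv w0 in vc.
have cl : in_coset w x' (raag_act base_act h^-1 (toggle c e1)) ->
    raag_act base_act h^-1 (toggle c e1) = toggle c x'.
  rewrite /in_coset wc => /orP[/eqP E|/eqP //].
  by have := @toggle_neq _ c e1; case; apply: (can_inj (raag_actK base_inv h^-1)).
have := flip e1 false false.
have := raag_act_commute ext_inv (e1, (false, false)) cvw.
case: (raag_act _ (_ ^ h) (e1, _)) => [p [i j]].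
rewrite !(raag_act_gen ext_inv) /= wv /= addbF => /(congr1 (fun z => z.2.1)) /=.
have -> : base_act v e1 = toggle c e1 by rewrite /coxeter_act vc.
by rewrite flip => -> /=; rewrite in_coset_refl; exact: cl.
Qed.

(** Up to conjugation this is the meeting of cosets along an edge. If [v] or [w] has a letter,
    [h^-1] acts as 1 or as that letter. *)
Lemma commute_coset (v w : G) h x : commute (raag_gen v) (raag_gen w ^ h) ->
  exists2 y, in_coset v x y & in_coset w y (raag_act base_act h^-1 x).
Proof.
move=> cvw; have vw := commute_star cvw.
set x' := raag_act base_act h^-1 x.
have close_to c u : star_letter u = Some c ->
    (forall x, raag_act base_act h^-1 x = x) \/
    (forall x, raag_act base_act h^-1 x = toggle c x) -> in_coset u x x'.
  by rewrite /in_coset => ->; case=> E; rewrite /x' E eqxx ?orbT.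
have self c : letter v = Some c ->
    (forall x, raag_act base_act h^-1 x = x) \/
    (forall x, raag_act base_act h^-1 x = toggle c x) ->
    exists2 y, in_coset v x y & in_coset w y x'.
  move=> vc E; exists x'; last exact: in_coset_refl.
  by apply: (close_to c) => //; apply: letter_star vc; rewrite /star eqxx.
case Ev: (letter v) => [c|]; case Ew: (letter w) => [d|].
- have wv : w = v.
    by move: vw; rewrite /star (negbTE (letter_indep Ev Ew)) orbF => /eqP.
  rewrite wv in cvw *; rewrite -[w in exists2 _, _ & in_coset w _ _]wv.
  apply: (self _ Ev); apply: coxeter_act_centralizer.
  have vE y : base_act v y = toggle c y by rewrite /coxeter_act Ev.
  (* [v ^ h] commutes with [v], so it acts as 1 or [c]; the former is impossible as toggles have no
     fixed points, and the latter makes [h^-1] commute with [c]. *)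
  have := @coxeter_act_centralizer _ _ letter (raag_gen v ^ h) c.
  rewrite -!vE -!(raag_act_gen base_inv) (raag_act_commute base_inv _ cvw).
  case=> // E.
  - have := E (raag_act base_act h e1).
    rewrite (raag_act_conj base_inv) (raag_actK base_inv) vE.
    by move/(can_inj (raag_actK base_inv h))/toggle_neq.
  - have := E e1; rewrite (raag_act_conj base_inv) !(raag_act_gen base_inv) !vE.
    by move=> <-; rewrite (raag_actK base_inv).
- exact: self _ Ev (commute_cone Ev Ew cvw).
- have cwv : commute (raag_gen w) (raag_gen v ^ h^-1).
    by rewrite /commute -[raag_gen w](conjgK h) -!conjMg cvw.
  exists x; first exact: in_coset_refl.
  apply: (close_to d); first by apply: letter_star Ew; rewrite /star eqxx.
  have [E|E] := commute_cone Ew Ev cwv; rewrite invgK in E; [left|right] => z.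
    by rewrite -{2}(raag_actKV base_inv h z) E.
  by rewrite -{2}(raag_actKV base_inv h z) E toggleK.
- (* If the two cosets were disjoint, v could act by an involution over the
     first one and w by a non-commuting one over the second. *)
  apply: contrapT => disj.
  have ST y : ~~ (in_coset v x y && in_coset w x' y).
    by apply/andP => -[xy yx']; apply: disj; exists y => //; exact: in_coset_sym.
  apply: (@dihedral_ext_noncommute G _ _ v w _ _ base_inv _ _ (fun=> ST) h x) cvw.
  + by move=> u y; exact: in_coset_act.
  + by move=> u y; exact: in_coset_act.
  + exact: in_coset_refl.
  + exact: in_coset_refl.
  + by rewrite /coxeter_act Ev.
  + by rewrite /coxeter_act Ew.
Qed.

(** The walk is accumulated backwards in [t], whose letters spell [y]; moving inside the coset of
    [v] to the next coset uses at most the letter of [v]. The last vertex is entered twice, as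
    [v ^ h] and as [w ^ h'], which gives the [.+2]. *)
Lemma ext_path_subseq p (v : G) h (w : G) h' t y :
  path (@ext_adj G) (raag_gen v ^ h) p ->
  last (raag_gen v ^ h) p = raag_gen w ^ h' ->
  sorted (@star _) (v :: t) -> in_coset v (raag_act base_act h^-1 e1) y ->
  subseq (val y) (pmap star_letter t) ->
  exists s, [/\ sorted (@star _) s, size s = (size p + size t).+2 &
    subseq (val (raag_act base_act h'^-1 e1)) (pmap star_letter s)].
Proof.
have next v1 h1 v2 h2 y1 : commute (raag_gen v1 ^ h1) (raag_gen v2 ^ h2) ->
    in_coset v1 (raag_act base_act h1^-1 e1) y1 ->
    star v1 v2 /\ exists2 z, in_coset v1 y1 z &
      in_coset v2 z (raag_act base_act h2^-1 e1).
  move=> c12 hy; have c12' : commute (raag_gen v1) (raag_gen v2 ^ (h2 * h1^-1)).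
    by rewrite /commute conjgM -[raag_gen v1](conjgK h1) -!conjMg c12.
  split; first exact: commute_star c12'.
  have [z hz] := commute_coset (raag_act base_act h1^-1 e1) c12'.
  rewrite -(raag_actM base_inv) invgM invgK mulKg => hz2; exists z => //.
  exact: in_coset_trans (in_coset_sym hy) hz.
elim: p v h t y => [|y1 p IH] v h t y /=.
- move=> _ e st hy sub.
  have cc : commute (raag_gen v ^ h) (raag_gen w ^ h') by rewrite e.
  have [vw [z yz hz]] := next _ _ _ _ _ cc hy.
  exists [:: w, v & t]; split => //=; first by rewrite star_sym vw.
  exact: in_coset_subseq hz (in_coset_subseq yz sub).
- move=> /andP[/asboolP[_ [v1 [h1 ->]] _ cc] hp] hl st hy sub.
  have [vw [z yz hz]] := next _ _ _ _ _ cc hy.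
  have := IH v1 h1 (v :: t) z hp hl; rewrite /= star_sym vw st addnS => /(_ isT).
  case; first exact: in_coset_sym.
  - exact: in_coset_subseq yz sub.
  by move=> s [? ? ?]; exists s; split; rewrite ?addSn.
Qed.
End ExtensionGraphCosets.

(** * Displacement estimates in the extension graph *)

Section Distance.
Variable G : connected_graph.
Implicit Types (x y z g : raag G).

Lemma raag_gen_inj : injective (@raag_gen G).
Proof.
move=> u v e; pose act (w : G) (x : bool) := (w == u) (+) x.
have act_inv : involutive_action act.
  by split=> [w x|w1 w2 x _]; rewrite /act addbA ?addbb // addbCA addbA.
have := raag_act_gen act_inv v false.
by rewrite -e (raag_act_gen act_inv) /act eqxx; case: eqP.
Qed.

Lemma ext_vertex_gen (v : G) : ext_vertex (raag_gen v).
Proof. by exists v, 1; rewrite conjg1. Qed.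

Lemma commute_gen (u v : G) : adj u v -> commute (raag_gen u) (raag_gen v).
Proof.
move=> uv; rewrite /commute -[LHS]/(raag_mul _ _) -[RHS]/(raag_mul _ _) !raag_mul_pi.
by apply/raag_eqP; exact: (word_equiv_comm [::] [::]).
Qed.

Lemma ext_adj_gen (u v : G) g : adj u v -> ext_adj (raag_gen u ^ g) (raag_gen v ^ g).
Proof.
move=> uv; apply/ext_adjJ/asboolP;
  split; [exact: ext_vertex_gen..| |exact: commute_gen].
by move=> /raag_gen_inj uv'; rewrite uv' adj_irr in uv.
Qed.

Lemma ext_dist_le x y n : ext_walk x y n -> (ext_dist x y <= n)%N.
Proof.
move=> h; rewrite /ext_dist; case: pselect => // ex.
by case: ex_minnP => m _; apply; apply/asboolP.
Qed.

Lemma ext_dist_walk x y : ext_vertex x -> ext_vertex y -> ext_walk x y (ext_dist x y).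
Proof.
move=> hx hy; rewrite /ext_dist; case: pselect => [ex|[]].
  by case: ex_minnP => m /asboolP.
by have [n hn] := ext_connected hx hy; exists n; apply/asboolP.
Qed.

Lemma ext_dist_triangle y x z : ext_vertex x -> ext_vertex y -> ext_vertex z ->
  (ext_dist x z <= ext_dist x y + ext_dist y z)%N.
Proof.
by move=> hx hy hz; apply: ext_dist_le; apply: ext_walk_cat; exact: ext_dist_walk.
Qed.

Lemma ext_distC x y : ext_vertex x -> ext_vertex y -> ext_dist x y = ext_dist y x.
Proof.
by move=> hx hy; apply/eqP; rewrite eqn_leq; apply/andP; split;
  apply: ext_dist_le; apply: ext_walk_sym; exact: ext_dist_walk.
Qed.

Lemma ext_distJ x y g : ext_vertex x -> ext_vertex y ->
  (ext_dist (x ^ g)%g (y ^ g)%g <= ext_dist x y)%N.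
Proof. by move=> hx hy; apply: ext_dist_le; apply: ext_walkJ; exact: ext_dist_walk. Qed.

Lemma ext_dist_displacement x y g : ext_vertex x -> ext_vertex y ->
  (ext_dist x (x ^ g)%g <= ext_dist y (y ^ g)%g + 2 * ext_dist x y)%N.
Proof.
move=> hx hy; have hxg := ext_vertexJ g hx; have hyg := ext_vertexJ g hy.
have := ext_dist_triangle hx hy hxg; have := ext_dist_triangle hy hyg hxg.
have := ext_distJ g hy hx; rewrite (ext_distC hy hx); lia.
Qed.

Lemma ext_dist_expgD x g m n : ext_vertex x ->
  (ext_dist x (x ^ (g ^+ (m + n)))%g <=
   ext_dist x (x ^ (g ^+ m))%g + ext_dist x (x ^ (g ^+ n))%g)%N.
Proof.
move=> hx; rewrite expgnDr conjgM addnC.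
apply: leq_trans (ext_dist_triangle hx (ext_vertexJ (g ^+ n) hx) _) _.
  by apply: ext_vertexJ; exact: ext_vertexJ.
by rewrite leq_add2l; apply: ext_distJ => //; exact: ext_vertexJ.
Qed.

Lemma ext_dist_refl x : ext_dist x x = 0.
Proof. by apply/eqP; rewrite -leqn0; apply: ext_dist_le; exists [::]. Qed.

Lemma ext_dist_expgM x g m n : ext_vertex x ->
  (ext_dist x (x ^ (g ^+ (m * n)))%g <= m * ext_dist x (x ^ (g ^+ n))%g)%N.
Proof.
move=> hx; elim: m => [|m IH]; first by rewrite !mul0n expg0 conjg1 ext_dist_refl.
rewrite !mulSn; apply: leq_trans (ext_dist_expgD _ _ _ hx) _.
by rewrite leq_add2l.
Qed.

End Distance.

(** The bounds keep [u n / n] within [c / (k * n)] of [p / k]. *)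
Lemma cvg_ratio (R : realType) (k p c : nat) (u : nat -> nat) : (0 < k)%N ->
  (forall n, (p * n <= k * u n + c)%N) -> (forall n, (k * u n <= p * n + c)%N) ->
  (((u n)%:R / n%:R : R) @[n --> \oo] --> (p%:R / k%:R : R))%R%classic.
Proof.
move=> k0 lo up; apply/cvgrPdist_le => e e0.
near=> n.
have n0 : (0 < n%:R :> R)%R by rewrite ltr0n; near: n; exact: nbhs_infty_gt.
have k0' : (0 < k%:R :> R)%R by rewrite ltr0n.
have -> : (p%:R / k%:R - (u n)%:R / n%:R =
    (p%:R * n%:R - k%:R * (u n)%:R) / (k%:R * n%:R) :> R)%R.
  by field; rewrite !lt0r_neq0.
rewrite normrM normfV (gtr0_norm (mulr_gt0 k0' n0)) ler_pdivrMr ?mulr_gt0 //.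
apply: (@le_trans _ _ c%:R%R).
  have := lo n; have := up n.
  rewrite -!(ler_nat R) !natrD !natrM => h1 h2.
  by rewrite ler_norml; apply/andP; split; lra.
have : (c%:R / (e * k%:R) <= n%:R :> R)%R.
  near: n; exact: nbhs_infty_ger.
by rewrite ler_pdivrMr ?mulr_gt0 // => h; apply: le_trans h _; rewrite mulrC -mulrA.
Unshelve. all: by end_near. Qed.

(** * The coned cycle *)

Section ConedCycle.
Variable k : nat.
Hypothesis k0 : (0 < k)%N.

Definition coned_cycle_vertex : finType := ('I_(3 * k).+1 + 'I_3)%type.

Definition cycle_next (i j : nat) : bool :=
  (j == i.+1) || (i == 3 * k)%N && (j == 0)%N.

Definition coned_cycle_adj : rel coned_cycle_vertex := fun u v =>
  match u, v with
  | inl i, inl j => cycle_next i j || cycle_next j i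
  | inl i, inr c | inr c, inl i => (i < 3 * k)%N && (i %% 3 == c)%N
  | inr _, inr _ => false
  end.

Lemma coned_cycle_sym : symmetric coned_cycle_adj.
Proof. by case=> [i|c] [j|d] //=; rewrite orbC. Qed.

Lemma coned_cycle_irr : irreflexive coned_cycle_adj.
Proof. by case=> [i|c] //=; rewrite /cycle_next; lia. Qed.

Lemma coned_cycle_inhabited : (0 < #|coned_cycle_vertex|)%N.
Proof. by apply/card_gt0P; exists (inr ord0). Qed.

Lemma coned_cycle_connected u v : connect coned_cycle_adj u v.
Proof.
have csym := sym_connect_sym coned_cycle_sym.
have cyc i (hi : (i < (3 * k).+1)%N) :
    connect coned_cycle_adj (inl ord0) (inl (Ordinal hi)).
  elim: i hi => [|i IH] hi; first by rewrite (_ : Ordinal hi = ord0) //; exact: val_inj.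
  apply: connect_trans (IH (ltnW hi)) (connect1 _).
  by rewrite /= /cycle_next eqxx.
suff root w : connect coned_cycle_adj (inl ord0) w.
  by apply: connect_trans (root v); rewrite csym.
case: w => [[i hi]|c]; first exact: cyc.
have hc : (c < (3 * k).+1)%N by case: c => /=; lia.
apply: connect_trans (cyc c hc) (connect1 _) => /=.
by case: c {hc} => /= c hc; rewrite modn_small // eqxx andbT; lia.
Qed.

Definition coned_cycle : connected_graph :=
  ConnectedGraph coned_cycle_sym coned_cycle_irr coned_cycle_inhabited
    coned_cycle_connected.

Definition cone_letter (v : coned_cycle) : option nat :=
  if v is inr c then Some (c : nat) else None.

Definition cone_star_letter (v : coned_cycle) : option nat :=
  match v with
  | inl i => if (i < 3 * k)%N then Some (i %% 3)%N else None
  | inr c => Some (c : nat)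
  end.

Lemma cone_letter_indep (u v : coned_cycle) c d :
  cone_letter u = Some c -> cone_letter v = Some d -> ~~ adj u v.
Proof. by case: u v => [i|a] [j|b]. Qed.

Lemma cone_letter_star (u v : coned_cycle) c :
  star u v -> cone_letter u = Some c -> cone_star_letter v = Some c.
Proof.
rewrite /star; case: u => [i|a] //; case: v => [j|b] /=.
  by move=> /andP[-> /eqP ->].
by rewrite orbF => /eqP[->].
Qed.

(** * Counting the letters spelled along a walk *)

Fixpoint descending (n : nat) : seq nat :=
  if n is m.+1 then (m %% 3)%N :: descending m else [::].

(* Matching the letters of [descending] in a walk read backwards, two
   consecutive letters can be matched by consecutive vertices only on a step
   from i.+1 to i of the cycle, so after reaching v at most [potential v] more
   letters come for free. *)
Definition potential (v : coned_cycle) : nat := if v is inl i then i else 0.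

(** Distinct letters exclude equal vertices and cone edges; residues mod 3 fix the direction along
    the cycle, and the closing edge is excluded because its end [3 * k] has no letter. *)
Lemma potential_step (v w : coned_cycle) m : star v w ->
  cone_star_letter v = Some (m.+1 %% 3)%N -> cone_star_letter w = Some (m %% 3)%N ->
  potential v = (potential w).+1.
Proof.
rewrite /star; case: eqP => [<-|_] /=.
  by move=> _ -> []; lia.
case: v w => [i|c] [j|d] //=; rewrite /cycle_next.
- by case: ifP => // hi; case: ifP => // hj + [] + []; lia.
- by case: ifP => // hi; move=> /eqP + [] + []; lia.
- by case: ifP => // hi; move=> /eqP + [] + []; lia.
Qed.

Lemma potential_lt (v : coned_cycle) c :
  cone_star_letter v = Some c -> (potential v < 3 * k)%N.
Proof. by case: v => [i|d] /=; [case: ifP | lia]. Qed.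

(** A letter costs [3 * k + 1] and a vertex pays [3 * k]. When [v] has just matched the preceding
    letter, a run of matches is financed by the potential, which drops by 1 each time; a skipped
    vertex pays for a new run. *)
Lemma subseq_descending (s : seq coned_cycle) : sorted (@star _) s ->
  (forall n, subseq (descending n) (pmap cone_star_letter s) ->
    ((3 * k).+1 * n <= 3 * k * (size s).+1)%N) /\
  (forall v n, sorted (@star _) (v :: s) -> cone_star_letter v = Some (n %% 3)%N ->
    subseq (descending n) (pmap cone_star_letter s) ->
    ((3 * k).+1 * n <= 3 * k * size s + potential v)%N).
Proof.
elim: s => [|w s IH] hs.
  by split=> [[|n]|v [|n]] //; lia.
have [A B] := IH (path_sorted hs).
have split_head n : subseq (descending n) (pmap cone_star_letter (w :: s)) ->
    subseq (descending n) (pmap cone_star_letter s) \/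
    exists m, [/\ n = m.+1, cone_star_letter w = Some (m %% 3)%N &
      subseq (descending m) (pmap cone_star_letter s)].
  case: n => [|m] /=; first by left; exact: sub0seq.
  case E: (cone_star_letter w) => [b|] /=; last by left.
  by case: eqP => [<-|_] h; [right; exists m | left].
split=> [n|v n] /=.
- move=> /split_head[/A h|[m [-> hw /(B w m hs hw) h]]].
    by apply: leq_trans h _; rewrite leq_mul2l leqnSn orbT.
  (* The letter costs [3 * k + 1] and the potential is at most [3 * k - 1]: together exactly two
     vertices' worth. *)
  move: (potential_lt hw) h => {hw}; move: (potential w) (size s) => p q.
  nia.
- move=> /andP[vw _] hv /split_head[/A h|[m [nm hw /(B w m hs hw) h]]].
    exact: leq_trans h (leq_addr _ _).
  by rewrite nm in hv *; rewrite (potential_step vw hv hw); move: h;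
     move: (potential w) (size s) => p q; nia.
Qed.

(** * The element and the two bounds on its displacement *)

Definition cycle_vertex (i : nat) : coned_cycle := inl (inord i).
Definition cone_vertex (c : nat) : coned_cycle := inr (inord c).

Definition spiral (n : nat) : raag coned_cycle :=
  iteri n (fun i h => raag_gen (cone_vertex (i %% 3)) * h) 1.

Definition rotor : raag coned_cycle := spiral 3.

Lemma spiral_mul3 n : spiral (3 * n) = rotor ^+ n.
Proof.
elim: n => [|n IH] //; rewrite expgS -IH mulnS /rotor /spiral /= -/(spiral _).
rewrite mulg1 -!mulgA.
by do !congr (_ * _); congr (raag_gen (cone_vertex _)); lia.
Qed.

Lemma spiralS n : spiral n.+1 = raag_gen (cone_vertex (n %% 3)) * spiral n.
Proof. by []. Qed.

Lemma cycle_vertexS i : (i < 3 * k)%N -> adj (cycle_vertex i) (cycle_vertex i.+1).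
Proof. by move=> hi; rewrite /= /cycle_next !inordK ?eqxx // ltnW. Qed.

Lemma cycle_vertex_last : adj (cycle_vertex (3 * k)) (cycle_vertex 0).
Proof. by rewrite /= /cycle_next !inordK ?eqxx ?orbT. Qed.

Lemma cycle_cone_adj i : (i < 3 * k)%N -> adj (cycle_vertex i) (cone_vertex (i %% 3)).
Proof. by move=> hi; rewrite /= !inordK ?hi ?eqxx ?ltn_mod // ltnW. Qed.

(** The cone of the current cycle vertex commutes with it, so the new left factor of [spiral] enters
    the conjugator at no cost. *)
Lemma spiral_walk i : (i <= 3 * k)%N ->
  ext_walk (raag_gen (cycle_vertex 0)) (raag_gen (cycle_vertex i) ^ spiral i) i.
Proof.
elim: i => [|i IH] hi; first by rewrite /= conjg1; exists [::].
rewrite -[in X in ext_walk _ _ X]addn1; apply: (ext_walk_cat (IH (ltnW hi))).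
have -> : raag_gen (cycle_vertex i) ^ spiral i =
    raag_gen (cycle_vertex i) ^ spiral i.+1.
  rewrite spiralS conjgM; congr (_ ^ _); apply/esym/conjg_fixP/commgP.
  exact/commute_gen/cycle_cone_adj.
exists [:: raag_gen (cycle_vertex i.+1) ^ spiral i.+1]; split => //=.
by rewrite ext_adj_gen //; exact: cycle_vertexS.
Qed.

Lemma rotor_walk :
  ext_walk (raag_gen (cycle_vertex 0))
    (raag_gen (cycle_vertex 0) ^ (rotor ^+ k)) (3 * k).+1.
Proof.
rewrite -spiral_mul3 -[X in ext_walk _ _ X]addn1.
apply: (ext_walk_cat (spiral_walk (leqnn _))).
exists [:: raag_gen (cycle_vertex 0) ^ spiral (3 * k)]; split => //=.
by rewrite ext_adj_gen //; exact: cycle_vertex_last.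
Qed.

(** Divide [n] by [k]: each full block costs at most [(3 * k).+1], and fewer than [k] single rotors
    remain. *)
Lemma rotor_dist_upper n (x := raag_gen (cycle_vertex 0)) :
  (k * ext_dist x (x ^ (rotor ^+ n))%g <=
   (3 * k).+1 * n + k * k * ext_dist x (x ^ rotor)%g)%N.
Proof.
have hx : ext_vertex x by exact: ext_vertex_gen.
have h1 := ext_dist_expgM rotor (n %/ k) k hx.
have h2 := ext_dist_expgM rotor (n %% k) 1 hx.
have h3 := ext_dist_expgD rotor (n %/ k * k) (n %% k) hx.
rewrite -divn_eq in h3; rewrite muln1 expg1 in h2.
have hk := ext_dist_le rotor_walk.
have h4 : (n %/ k * ext_dist x (x ^ (rotor ^+ k))%g <= n %/ k * (3 * k).+1)%N.
  by rewrite leq_mul2l hk orbT.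
have h5 : (n %% k * ext_dist x (x ^ rotor)%g <= k * ext_dist x (x ^ rotor)%g)%N.
  by rewrite leq_mul2r ltnW ?orbT // ltn_mod.
have h6 : (n %/ k * k <= n)%N by exact: leq_divM.
have h7 := leq_trans h3 (leq_add (leq_trans h1 h4) (leq_trans h2 h5)).
rewrite -mulnA; apply: leq_trans (leq_mul (leqnn k) h7) _.
by rewrite mulnDr leq_add2r mulnA (mulnC k) mulnC leq_mul2l h6 orbT.
Qed.

(** Successive residues mod 3 differ, so no letters cancel. *)
Lemma coxeter_act_spiralV n :
  val (raag_act (coxeter_act cone_letter) (spiral n)^-1 (coxeter1 _)) = descending n.
Proof.
have ai := coxeter_act_inv cone_letter_indep.
elim: n => [|n IH]; first by rewrite invg1 (raag_act1 ai).
rewrite spiralS invgM (raag_actM ai) (raag_act_genV ai).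
rewrite /coxeter_act /= IH inordK ?ltn_mod //.
by case: n {IH} => //= n; case: eqP => //; lia.
Qed.

Lemma rotor_dist_lower n (x := raag_gen (cycle_vertex 0)) :
  ((3 * k).+1 * n <= k * ext_dist x (x ^ (rotor ^+ n))%g + k * 3)%N.
Proof.
have hx : ext_vertex x by exact: ext_vertex_gen.
have [p [hp hl hs]] := ext_dist_walk hx (ext_vertexJ (rotor ^+ n) hx).
rewrite -[x]conjg1 in hp; rewrite -{1}[x]conjg1 in hl.
have ai := coxeter_act_inv cone_letter_indep.
have [|s [ss sz sub]] := ext_path_subseq cone_letter_indep cone_letter_star
  (t := [::]) (y := coxeter1 _) hp hl isT _ isT.
  by rewrite invg1 (raag_act1 ai) in_coset_refl.
rewrite -spiral_mul3 coxeter_act_spiralV in sub.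
(* The additive 3 collects the two extra vertices of [s] and the successor in the counting bound; a
   common factor 3 then cancels. *)
have := (subseq_descending ss).1 _ sub; rewrite sz hs addn0.
by rewrite -mulnDr mulnCA -mulnA leq_pmul2l // addn3.
Qed.

End ConedCycle.

Theorem theorem5 (R : realType) (k : nat) (hk : (2 < k)%N) :
  exists (G : connected_graph) (g : raag G),
    asymptotic_translation_length g (3 + 1 / k%:R : R)%R.
Proof.
have k0 : (0 < k)%N by lia.
exists (coned_cycle k0), (rotor k0) => x hx.
have -> : (3 + 1 / k%:R = (3 * k).+1%:R / k%:R :> R)%R.
  have -> : ((3 * k).+1%:R = 3 * k%:R + 1 :> R)%R by rewrite -natrM natr1.
  by field; rewrite pnatr_eq0 -lt0n.
set y := raag_gen (cycle_vertex k0 0).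
have hy : ext_vertex y by exact: ext_vertex_gen.
(* One constant absorbs the additive errors of both estimates and the change of base vertex from [y]
   to [x]. *)
pose bound := k * k * ext_dist y (y ^ rotor k0)%g + k * 3 +
  k * (2 * (ext_dist x y + ext_dist y x)).
apply: (@cvg_ratio _ _ _ bound) => // n; rewrite /bound.
- have h1 := rotor_dist_lower k0 n.
  have := ext_dist_displacement (rotor k0 ^+ n) hy hx.
  rewrite -(leq_pmul2l k0) => h2; rewrite -/y in h1; nia.
- have h1 := rotor_dist_upper k0 n.
  have := ext_dist_displacement (rotor k0 ^+ n) hx hy.
  rewrite -(leq_pmul2l k0) => h2; rewrite -/y in h1; nia.
Qed.
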